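(* Let $q=2^e$ with $e\geq 1$, let $S$ be a Singer cycle of $\mathrm{PG}(3,q)$, and let $S_1$ and $S_2$ be the subgroups of $S$ of order $q+1$ and $q^2+1$ respectively. Let $\mathcal{S}$ be a regular line spread of $\mathrm{PG}(3,q)$ stabilised by $S$ and such that $S_1$ fixes every line of $\mathcal{S}$ and acts transitively on the points of each line of $\mathcal{S}$. Let $\mathcal{O}$ be an elliptic quadric of $\mathrm{PG}(3,q)$ such that every line of $\mathcal{S}$ is tangent to $\mathcal{O}$ and $S_2$ acts regularly on $\mathcal{O}$. Then the lines tangent to $\mathcal{O}$ through a fixed point $P$ form a starter set of $\mathrm{PG}(3,q)$ (for the incidence structure of points and lines of $\mathrm{PG}(3,q)$, with respect to the group $S$).
   Context: A Singer cycle of $\mathrm{PG}(3,q)$ is a cyclic collineation group acting regularly on the points; it has order $q^3+q^2+q+1=(q+1)(q^2+1)$. For example, identifying the underlying vector space with $\mathrm{GF}(q^4)$ and letting $\alpha$ be a generator of the multiplicative group of $\mathrm{GF}(q^4)$, the map $x\mapsto\alpha x$ induces a generator of a Singer cycle. Starter set: let $(\mathcal{P},\mathcal{L})$ be an incidence structure with a collineation group $G$ acting regularly on the points, and fix a point $P\in\mathcal{P}$. A set $\mathcal{T}=\{\ell_1,\ell_2,\ldots,\ell_h\}$ of blocks incident with $P$ is a starter set if (1) $\ell_i^g\neq\ell_j$ for any $g\in G$ and $1\leq i<j\leq h$; and (2) for any block $\ell\in\mathcal{L}$ there are a block $\ell_i\in\mathcal{T}$ and a $g\in G$ such that $\ell=\ell_i^g$.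 Here $\mathcal{P}$ and $\mathcal{L}$ are the sets of points and lines of $\mathrm{PG}(3,q)$ and $G=S$. A line spread of $\mathrm{PG}(3,q)$ is a set of mutually disjoint lines such that each point belongs to exactly one of them. A regulus of $\mathrm{PG}(3,q)$ is a set $\mathcal{R}$ of $q+1$ mutually disjoint lines such that each line meeting three elements of $\mathcal{R}$ meets all elements of $\mathcal{R}$; any three mutually disjoint lines $A,B,C$ lie in a unique regulus $\mathcal{R}(A,B,C)$. A line spread is regular if it contains $\mathcal{R}(A,B,C)$ whenever $A,B,C$ are three distinct elements of it. $Q^-(3,q)$ denotes the set of points of $\mathrm{PG}(3,q)$ whose homogeneous coordinates satisfy $X_0X_1+X_2^2+bX_2X_3+cX_3^2=0$, where $\xi^2+b\xi+c$ is an irreducible polynomial over $\mathrm{GF}(q)$. A set of points $\mathcal{O}$ is an elliptic quadric if $\mathcal{O}^{\varphi}=Q^-(3,q)$ for some collineation $\varphi$ of $\mathrm{PG}(3,q)$. A line is tangent to $\mathcal{O}$ if it meets $\mathcal{O}$ in exactly one point.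
   Formalization: The fixed point P is required to lie on the elliptic quadric O; for P not on O the claim fails (already for q=2), since two distinct tangents to O through P then lie in the same S-orbit. *)

(* Defs.v *)
From HB Require Import structures.
From mathcomp Require Import all_boot all_order all_algebra all_fingroup all_solvable.

Set Implicit Arguments.
Unset Strict Implicit.
Unset Printing Implicit Defensive.

Import GRing.Theory.
Local Open Scope ring_scope.

(* Subspaces over a finite field form a finite type (as a subtype of matrices),
   which makes {set _} and {perm _} available on the points of PG(3,F). *)
Section FiniteSubspaces.
Import VectorInternalTheory.
Variables (F : finFieldType) (vT : vectType F).
HB.instance Definition _ := [Countable of {vspace vT} by <:].
HB.instance Definition _ := [Finite of {vspace vT} by <:].
End FiniteSubspaces.

Section PG3.
Variable F : finFieldType.

Definition point := {U : {vspace 'rV[F]_4} | \dim U == 1%N}.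

Definition points_of (U : {vspace 'rV[F]_4}) : {set point} :=
  [set P : point | (val P <= U)%VS].

Definition lines : {set {set point}} :=
  [set points_of U | U : {vspace 'rV[F]_4} & \dim U == 2%N].

Definition collineations : {set {perm point}} :=
  [set f : {perm point} |
    [forall l : {set point}, (f @: l \in lines) == (l \in lines)]].

Definition acts_regularly (T : finType) (G : {set {perm T}}) (X : {set T}) :=
  [transitive G, on X | 'P] /\ {in X, forall x, 'C_G[x | 'P]%g = 1%g}.

Definition singer_cycle (S : {group {perm point}}) :=
  [/\ S \subset collineations, cyclic S & acts_regularly S [set: point]].

Definition line_spread (Sp : {set {set point}}) :=
  Sp \subset lines /\ partition Sp [set: point].

Definition regulus (R : {set {set point}}) :=
  [/\ R \subset lines, #|R| = #|F|.+1, trivIset R &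
      forall m A B C, m \in lines -> A \in R -> B \in R -> C \in R ->
        uniq [:: A; B; C] ->
        ~~ [disjoint m & A] -> ~~ [disjoint m & B] -> ~~ [disjoint m & C] ->
        forall D, D \in R -> ~~ [disjoint m & D]].

(* Three mutually disjoint lines lie in a unique regulus R(A,B,C), so
   quantifying over the reguli R through A, B, C is quantifying over
   R(A,B,C) alone. *)
Definition regular_spread (Sp : {set {set point}}) :=
  line_spread Sp /\
  forall A B C, A \in Sp -> B \in Sp -> C \in Sp -> uniq [:: A; B; C] ->
    forall R, regulus R -> A \in R -> B \in R -> C \in R -> R \subset Sp.

Definition elliptic_form (b c : F) (v : 'rV[F]_4) : F :=
  let X (i : nat) := v ord0 (inord i) in
  X 0%N * X 1%N + X 2%N ^+ 2 + b * X 2%N * X 3%N + c * X 3%N ^+ 2.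

(* The form is homogeneous, so its vanishing at one nonzero vector of a point
   is equivalent to its vanishing at all vectors of that point. *)
Definition Qminus (b c : F) : {set point} :=
  [set P : point | [forall v : 'rV[F]_4,
    (v \in val P) ==> (elliptic_form b c v == 0)]].

(* All choices of b and c with X^2 + bX + c irreducible give projectively
   equivalent quadrics, so the existential over b and c does not enlarge the
   class obtained from a fixed choice. *)
Definition elliptic_quadric (O : {set point}) :=
  exists b c : F, irreducible_poly ('X^2 + b *: 'X + c%:P) /\
  exists2 phi : {perm point}, phi \in collineations & phi @: O = Qminus b c.

Definition tangent_lines (O : {set point}) : {set {set point}} :=
  [set l in lines | #|l :&: O| == 1%N].

End PG3.

Definition starter_set (T : finType) (L : {set {set T}}) (G : {set {perm T}})
    (P : T) (St : {set {set T}}) :=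
  [/\ St \subset L,
      forall l : {set T}, l \in St -> P \in l,
      forall l m : {set T}, l \in St -> m \in St -> l != m ->
        forall g : {perm T}, g \in G -> g @: l != m &
      forall l, l \in L ->
        exists (m : {set T}) (g : {perm T}), [/\ m \in St, g \in G & l = g @: m]].

(* Main.v *)
Require Import Defs.
From mathcomp Require Import all_boot all_order all_algebra all_fingroup all_solvable.
From mathcomp Require Import finfield ring zify.

Set Implicit Arguments.
Unset Strict Implicit.
Unset Printing Implicit Defensive.

(** The group [S] is regular on points, so the sum of [#|l :&: O^g|] over [g] in
    [S] is [#|l| * #|O| = (q + 1)(q^2 + 1)], which is odd for [q] even. Since a
    line meets an elliptic quadric in at most two points, some translate of [l]
    meets [O] in exactly one point, and [S2], transitive on [O], moves that
    point to [P]: every line is [S]-equivalent to a tangent through [P].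
    Conversely there are [q + 1] tangents through [P], one of them in the
    spread; the [q^2 + q] lines through [P] outside the spread fall into
    [S]-orbits each containing at most [q + 1] lines through [P], hence into at
    least [q] orbits, so the [q] tangents outside the spread are pairwise
    inequivalent. *)

Import GRing.Theory.

(** * Counting in finite sets, images under permutations, and pencils of lines *)

Lemma card_setI_sum (T : finType) (A B : {set T}) :
  #|A :&: B| = \sum_(x in A) (x \in B).
Proof.
rewrite -sum1_card big_mkcond [RHS]big_mkcond; apply: eq_bigr => x _.
by rewrite inE; do 2 case: (x \in _).
Qed.

Lemma card_bigcup_le (I T : finType) (A : {set I}) (B : I -> {set T}) :
  #|\bigcup_(i in A) B i| <= \sum_(i in A) #|B i|.
Proof.
elim/big_rec2: _ => [|i n X _ IH]; first by rewrite cards0.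
by apply: leq_trans (leq_card_setU _ _) _; rewrite leq_add2l.
Qed.

Lemma perm_imset_mul (T : finType) (g h : {perm T}) (A : {set T}) :
  (g * h)%g @: A = h @: (g @: A).
Proof. by rewrite -imset_comp; apply: eq_imset => x /=; rewrite permM. Qed.

Lemma perm_imsetK (T : finType) (g : {perm T}) (A : {set T}) :
  g^-1%g @: (g @: A) = A.
Proof.
rewrite -perm_imset_mul mulgV; under eq_imset do rewrite perm1.
exact: imset_id.
Qed.

Lemma perm_imsetKV (T : finType) (g : {perm T}) (A : {set T}) :
  g @: (g^-1%g @: A) = A.
Proof. by rewrite -{1}(invgK g) perm_imsetK. Qed.

(** The lines through [P] partition the points other than [P], because each such point is joined to
    [P] by exactly one line. Each [.-1] discards [P] itself, which lies in both sets, so no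
    predecessor is truncated. *)
Lemma sum_pencil (T : finType) (L : {set {set T}}) (P : T) (X : {set T}) :
    (forall Q, Q != P -> exists2 l, l \in L & (P \in l) && (Q \in l)) ->
    (forall Q l m, Q != P -> l \in L -> m \in L ->
       P \in l -> Q \in l -> P \in m -> Q \in m -> l = m) ->
  P \in X -> \sum_(l in L | P \in l) #|l :&: X|.-1 = #|X|.-1.
Proof.
move=> exL uL PX; rewrite (cardsD1 P X) PX /= -sum1_card.
transitivity (\sum_(l in L | P \in l) \sum_(Q in X :\ P) (Q \in l)).
  apply: eq_bigr => l /andP[_ Pl].
  by rewrite -card_setI_sum (cardsD1 P (l :&: X)) inE Pl PX /= setIC setIDAC.
rewrite exchange_big; apply: eq_bigr => Q /setD1P[QP _].
have [l lL /andP[Pl Ql]] := exL Q QP.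
rewrite (bigD1 l) ?lL //= Ql big1 // => m /andP[/andP[mL Pm] ml].
by case: (boolP (Q \in m)) => // Qm; rewrite (uL Q m l) ?eqxx in ml.
Qed.

(** * Double counting with a regular permutation group *)

Section RegularGroup.
Variables (T : finType) (G : {group {perm T}}).
Hypothesis Greg : acts_regularly G [set: T].

Lemma card_regular_transporter (x y : T) : #|[set g in G | g x == y]| = 1.
Proof.
have [Gtr Gfree] := Greg.
have [g gG ->] := atransP2 Gtr (in_setT x) (in_setT y).
rewrite -(cards1 g); apply: eq_card => h; rewrite !inE /= apermE.
apply/andP/eqP => [[hG /eqP hx]|->]; last by [].
have: (h * g^-1)%g \in 'C_G[x | 'P]%g.
  rewrite inE groupM ?groupV //=.
  by apply/astab1P; rewrite /= apermE permM hx permK.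
by rewrite Gfree ?in_setT // => /set1P/eqP; rewrite -eq_mulgV1 => /eqP.
Qed.

(** Both sides count the pairs in [A] x [B]: by regularity exactly one [g] carries a given [y] in
    [B] to a given [x] in [A]. *)
Lemma sum_card_translates (A B : {set T}) :
  \sum_(g in G) #|A :&: g @: B| = #|A| * #|B|.
Proof.
transitivity (\sum_(g in G) \sum_(x in A) \sum_(y in B) (g y == x)).
  apply: eq_bigr => g _; rewrite card_setI_sum; apply: eq_bigr => x _.
  (* Only the preimage of [x] under [g] can contribute to the sum over [B]. *)
  rewrite -[x in LHS](permKV g) mem_imset; last exact: perm_inj.
  under eq_bigr => y _ do rewrite (can2_eq (permK g) (permKV g)).
  have [yB|yB] := boolP (_ \in B).
    by rewrite (bigD1 _ yB) /= eqxx big1 // => z /andP[_ /negbTE->].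
  by rewrite big1 // => z zB; case: eqP => // zE; rewrite -zE zB in yB.
rewrite exchange_big -sum_nat_const /=; apply: eq_bigr => x _.
rewrite exchange_big -sum1_card /=; apply: eq_bigr => y _.
rewrite -(card_regular_transporter y x) -sum1_card [RHS]big_mkcond [LHS]big_mkcond.
by apply: eq_bigr => g _; rewrite inE; case: (g \in G); case: (_ == _).
Qed.

(** Taking [A] to be the singleton of [P] in the previous count shows that exactly [#|m|] elements
    [g] give [P \in g @: m]. Every set counted here is [g @: m] for such a [g]. *)
Lemma card_orbit_pencil (P : T) (m : {set T}) :
  #|[set l in [set g @: m | g : {perm T} in G] | P \in l]| <= #|m|.
Proof.
have <-: \sum_(g in G) #|[set P] :&: g @: m| = #|m|.
  by rewrite sum_card_translates cards1 mul1n.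
have -> : \sum_(g in G) #|[set P] :&: g @: m|
          = #|[set g in G | P \in (g : {perm T}) @: m]|.
  rewrite -sum1_card [RHS]big_mkcond [LHS]big_mkcond; apply: eq_bigr => g _.
  by rewrite card_setI_sum big_set1 inE; case: (g \in G); case: (_ \in _).
apply: leq_trans (leq_imset_card (fun g : {perm T} => g @: m) _).
apply/subset_leq_card/subsetP => l /[!inE] /andP[/imsetP[g gG ->] Pl].
by apply/imsetP; exists g; rewrite // inE gG.
Qed.

(** If two starters were equivalent, one could be dropped. Without it and the spread line [l0], only
    [q - 1] starters would remain to cover [q ^ 2 + q] lines through [P], at most [q + 1] each. *)
Lemma starter_set_by_counting (L Sp St : {set {set T}}) (P : T) (q : nat) :
    St \subset L -> (forall l, l \in St -> P \in l) ->
    (forall l, l \in L -> #|l| = q.+1) ->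
    #|[set l in L | P \in l]| = q ^ 2 + q + 1 -> #|St| = q.+1 ->
    (forall (g : {perm T}) l, g \in G -> l \in Sp -> g @: l \in Sp) ->
    (exists l0, [set l in Sp | P \in l] = [set l0] /\ l0 \in St) ->
    (forall l, l \in L ->
       exists m (g : {perm T}), [/\ m \in St, g \in G & l = g @: m]) ->
  starter_set L G P St.
Proof.
move=> StL StP cL cP cSt stab [l0 [l0E l0St]] cover.
split=> // l m lSt mSt lm g gG.
apply/eqP => gl.
have l0P k : k \in Sp -> P \in k -> k = l0.
  by move=> kSp Pk; apply/set1P; rewrite -l0E inE kSp.
have l0Sp : l0 \in Sp by have := set11 l0; rewrite -l0E inE => /andP[].
(* Were [l] in the spread, so would be its image [m]; both pass through [P], so both would equal
   [l0]. *)
have lSp : l \notin Sp.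
  apply/negP => lSp; move/eqP: lm; apply; rewrite (l0P l) ?StP //.
  by rewrite [RHS](l0P m) ?StP // -gl stab.
have mSp : m \notin Sp.
  apply/negP => mSp; move/negP: lSp; apply.
  by rewrite -(perm_imsetK g l) gl stab ?groupV.
pose R := St :\ l0 :\ m.
have cR : #|R|.+1 = q.
  have := cardsD1 l0 St; rewrite l0St cSt => -[/esym].
  rewrite (cardsD1 m) !inE mSt (_ : m != l0) 1?eq_sym //=.
  by apply: contraNneq mSp => <-.
pose orb (k : {set T}) := [set h @: k | h : {perm T} in G].
pose N := [set k in L | P \in k] :\ l0.
have cN : #|N| = q ^ 2 + q.
  have := cardsD1 l0 [set k in L | P \in k]; rewrite cP inE (subsetP StL) // StP //.
  by rewrite -/N /=; lia.
have sub : N \subset \bigcup_(k in R) [set x in orb k | P \in x].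
  apply/subsetP => k; rewrite !inE => /andP[kl0 /andP[kL Pk]].
  have [n [h [nSt hG kE]]] := cover k kL.
  have nl0 : n != l0.
    apply: contraNneq kl0 => nl0; rewrite [k]l0P // kE nl0 stab //.
  (* A line in the orbit of the discarded [m] is reached from [l] instead, since [g @: l = m]. *)
  have [nm|nm] := eqVneq n m; apply/bigcupP.
    exists l; rewrite !inE ?lSt ?lm ?Pk ?andbT //=.
      by apply: contraNneq lSp => ->.
    apply/imsetP; exists (g * h)%g; first by rewrite groupM.
    by rewrite perm_imset_mul gl -nm.
  exists n; rewrite !inE ?nSt ?nl0 ?nm ?Pk ?andbT //.
  by apply/imsetP; exists h.
have := subset_leq_card sub; rewrite cN.
have : #|\bigcup_(k in R) [set x in orb k | P \in x]| <= #|R| * q.+1.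
  rewrite -sum_nat_const; apply: leq_trans (card_bigcup_le _ _) _.
  apply: leq_sum => k kR; apply: leq_trans (card_orbit_pencil P k) _.
  by rewrite cL // (subsetP StL) //; move: kR; rewrite !inE => /and3P[].
(* The contradiction is [(q - 1) * (q + 1) < q ^ 2 + q]. *)
by move=> u v; have := leq_trans v u; nia.
Qed.

End RegularGroup.

(** * Incidence and point counts in the projective space *)

Section Incidence.
Variable F : finFieldType.
Implicit Types (P Q : point F) (U V : {vspace 'rV[F]_4}).

Lemma val_point_vline P (v : 'rV[F]_4) : v != 0%R -> v \in val P -> val P = <[v]>%VS.
Proof.
move=> v0 vP; apply/eqP; rewrite eq_sym eqEdim -memvE vP dim_vline v0.
by rewrite (eqP (valP P)).
Qed.

Lemma card_subspace U : #|[set v : 'rV[F]_4 | v \in U]| = #|F| ^ \dim U.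
Proof. by rewrite cardsE; apply: card_vspace. Qed.

(** The nonzero vectors of [U] are grouped by the point they span, with [#|F|.-1] of them in each
    group; the successor accounts for the zero vector. *)
Lemma card_points_of U : (#|points_of U| * #|F|.-1).+1 = #|F| ^ \dim U.
Proof.
rewrite -card_subspace (cardsD1 0%R) inE mem0v add1n; congr _.+1.
rewrite -[RHS]sum1_card.
pose line_of (v : 'rV[F]_4) : {vspace 'rV[F]_4} := <[v]>%VS.
rewrite (partition_big line_of (fun W => (\dim W == 1) && (W <= U)%VS)); last first.
  by move=> v; rewrite !inE => /andP[v0 vU]; rewrite /line_of dim_vline v0 -memvE.
rewrite -sum_nat_const.
transitivity (\sum_(W : {vspace 'rV[F]_4} | (\dim W == 1) && (W <= U)%VS) #|F|.-1).
  rewrite !sum_nat_const; congr (_ * _).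
  rewrite -(card_imset _ val_inj); apply: eq_card => W.
  rewrite unfold_in; apply/imsetP/andP => [[Q]|[W1 WU]].
    by rewrite inE => QU ->; split=> //; apply: (valP Q).
  by exists (Sub W W1); rewrite ?inE SubK.
apply: eq_bigr => W /andP[/eqP W1 WU].
have: #|[set v : 'rV[F]_4 | v \in W]| = #|F| by rewrite card_subspace W1 expn1.
rewrite (cardsD1 0%R) inE mem0v add1n => <-; rewrite /= -sum1_card; apply: eq_bigl => v.
rewrite !inE /line_of; have [->|v0] //= := eqVneq v 0%R.
apply/idP/andP => [vW|[_ /eqP<-]]; last exact: memv_line.
split; first exact: subvP WU _ vW.
by rewrite eqEdim -memvE vW dim_vline v0 W1.
Qed.

Lemma card_line (l : {set point F}) : l \in lines F -> #|l| = #|F|.+1.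
Proof.
case/imsetP => U /[!inE] /eqP U2 ->.
have := card_points_of U; rewrite U2; have := finNzRing_gt1 F.
(* Writing [#|F|] as [k.+2] makes [#|F|.-1] a positive factor that can be cancelled. *)
case: #|F| => [|[|k]] // _ cU; apply/eqP; rewrite -(@eqn_pmul2r k.+1) //.
by apply/eqP/succn_inj; rewrite [LHS]cU; ring.
Qed.

Lemma card_points : #|{: point F}| = (#|F|.+1 * (#|F| ^ 2).+1)%N.
Proof.
have <- : #|points_of (fullv : {vspace 'rV[F]_4})| = #|{: point F}|.
  by apply: eq_card => Q; rewrite !inE subvf.
have := card_points_of fullv; rewrite dimvf /dim /= mul1n; have := finNzRing_gt1 F.
case: #|F| => [|[|k]] // _ cU; apply/eqP; rewrite -(@eqn_pmul2r k.+1) //.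
by apply/eqP/succn_inj; rewrite [LHS]cU; ring.
Qed.

Lemma dim_add_points P Q : P != Q -> \dim (val P + val Q) = 2%N.
Proof.
move=> PQ; rewrite dimv_disjoint_sum ?(eqP (valP P)) ?(eqP (valP Q)) //.
apply/eqP; rewrite -subv0; apply/subvP => v /memv_capP[vP vQ].
rewrite memv0; apply: contraNT PQ => v0; apply/eqP/val_inj.
by rewrite (val_point_vline v0 vP) (val_point_vline v0 vQ).
Qed.

Lemma exists_line P Q : P != Q ->
  exists2 l, l \in lines F & (P \in l) && (Q \in l).
Proof.
move=> PQ; exists (points_of (val P + val Q)).
  by apply: imset_f; rewrite inE dim_add_points.
by rewrite !inE addvSl addvSr.
Qed.

Lemma points_of_line P Q U : P != Q -> \dim U = 2%N ->
  P \in points_of U -> Q \in points_of U -> U = (val P + val Q)%VS.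
Proof.
move=> PQ U2 /[!inE] PU QU; apply/eqP.
by rewrite eq_sym eqEdim dim_add_points // U2 subv_add PU QU.
Qed.

Lemma line_unique P Q l m : P != Q -> l \in lines F -> m \in lines F ->
  P \in l -> Q \in l -> P \in m -> Q \in m -> l = m.
Proof.
move=> PQ /imsetP[U U2 ->] /imsetP[V V2 ->] PU QU PV QV.
move: U2 V2; rewrite !inE => /eqP U2 /eqP V2.
by rewrite (points_of_line PQ U2 PU QU) (points_of_line PQ V2 PV QV).
Qed.

Lemma sum_line_pencil P (X : {set point F}) : P \in X ->
  \sum_(l in lines F | P \in l) #|l :&: X|.-1 = #|X|.-1.
Proof.
apply: sum_pencil => [Q QP|Q l m QP lL mL Pl Ql Pm Qm].
  by apply: exists_line; rewrite eq_sym.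
by apply: (line_unique (P := Q) (Q := P)).
Qed.

Lemma card_line_pencil P :
  #|[set l in lines F | P \in l]| = (#|F| ^ 2 + #|F| + 1)%N.
Proof.
have := sum_line_pencil (in_setT P); rewrite cardsT card_points.
rewrite (eq_bigr (fun=> #|F|)); last first.
  by move=> l /andP[lL _]; rewrite setIT card_line.
have -> : #|[set l in lines F | P \in l]| = #|[pred l in lines F | P \in l]|.
  by apply: eq_card => l; rewrite inE.
rewrite sum_nat_const; have := finNzRing_gt1 F.
case: #|F| => [|[|k]] // _ cP; apply/eqP; rewrite -(@eqn_pmul2r k.+2) //.
by apply/eqP/succn_inj; rewrite [X in X.+1 = _]cP prednK //; ring.
Qed.

(** In the pencil sum for [O] a tangent contributes 0 and a secant 1, so [#|F| ^ 2] of the lines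
    through [P] are secants. *)
Lemma card_tangent_pencil P (O : {set point F}) :
    (forall l, l \in lines F -> #|l :&: O| <= 2) -> P \in O ->
    #|O| = (#|F| ^ 2 + 1)%N ->
  #|[set l in tangent_lines O | P \in l]| = #|F|.+1.
Proof.
move=> arc PO cO; set N := [set l in lines F | P \in l].
have secants : #|N :\: tangent_lines O| = (#|F| ^ 2)%N.
  have := sum_line_pencil PO; rewrite cO addn1 /= => <-.
  rewrite -sum1_card [LHS]big_mkcond [RHS]big_mkcond; apply: eq_bigr => l _.
  rewrite !inE; have [lL|] := boolP (l \in lines F); last by rewrite andbF.
  have [Pl|] := boolP (P \in l); last by rewrite /= andbF.
  have: 0 < #|l :&: O|.
    by apply/card_gt0P; exists P; rewrite inE Pl.
  by move: (arc l lL); case: #|l :&: O| => [|[|[|n]]].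
have := cardsID (tangent_lines O) N; rewrite secants card_line_pencil.
have -> : N :&: tangent_lines O = [set l in tangent_lines O | P \in l].
  by apply/setP => l; rewrite !inE; case: (l \in lines F); rewrite ?andbF // andbC.
by lia.
Qed.

End Incidence.

(** * Vectors with a prescribed zero coordinate *)

Section Coordinates.
Variable F : finFieldType.
Local Open Scope ring_scope.

(** The [i]-th coordinate is a linear map to a 1-dimensional space, so by rank-nullity its kernel
    meets [U] nontrivially. *)
Lemma exists_zero_coord (U : {vspace 'rV[F]_4}) (i : 'I_4) : \dim U = 2%N ->
  exists2 u, u \in U & (u != 0) && (u ord0 i == 0).
Proof.
move=> U2.
pose f : 'Hom('rV[F]_4, 'rV[F]_1) := linfun (mulmxr (delta_mx i ord0 : 'M[F]_(4, 1))).
have : (U :&: lker f)%VS != 0%VS.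
  rewrite -dimv_eq0 -lt0n.
  have := limg_ker_dim f U; have := dimvS (subvf (f @: U)%VS).
  rewrite U2 dimvf /dim /= => f1; case: (\dim (U :&: _)) => // f2.
  by rewrite add0n in f2; rewrite f2 in f1.
rewrite -vpick0 => h; exists (vpick (U :&: lker f)%VS).
  by have /memv_capP[] := memv_pick (U :&: lker f)%VS.
rewrite h /=; have /memv_capP[_] := memv_pick (U :&: lker f)%VS.
rewrite memv_ker lfunE /= => /eqP/matrixP/(_ ord0 ord0)/eqP.
rewrite !mxE (bigD1 i) //= big1 => [|j ji]; rewrite !mxE ?(negbTE ji) ?mulr0 //.
by rewrite !eqxx mulr1 addr0.
Qed.

Lemma row4_eq0 (u : 'rV[F]_4) : (forall k, (k < 4)%N -> u ord0 (inord k) = 0) -> u = 0.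
Proof.
by move=> u0; apply/rowP => j; rewrite mxE -(u0 j (ltn_ord j)) inord_val.
Qed.

End Coordinates.

(** * Lines meet an elliptic quadric in at most two points *)

Section Quadric.
Variable F : finFieldType.
Local Open Scope ring_scope.
Variables b c : F.
Hypothesis irr : irreducible_poly ('X^2 + b *: 'X + c%:P : {poly F}).

Definition elliptic_polar (u v : 'rV[F]_4) : F :=
  elliptic_form b c (u + v) - elliptic_form b c u - elliptic_form b c v.

Lemma elliptic_form_comb (s t : F) (u v : 'rV[F]_4) :
  elliptic_form b c (s *: u + t *: v) =
  s ^+ 2 * elliptic_form b c u + s * t * elliptic_polar u v + t ^+ 2 * elliptic_form b c v.
Proof. by rewrite /elliptic_polar /elliptic_form !mxE; ring. Qed.

Lemma irr_no_root (x : F) : x ^+ 2 + b * x + c != 0.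
Proof.
apply: contraTneq isT => rx.
have sz : size ('X^2 + b *: 'X + c%:P : {poly F}) = 3%N.
  rewrite -addrA size_polyDl size_polyXn // ltnS.
  apply: leq_trans (size_polyD _ _) _; rewrite geq_max.
  rewrite (leq_trans (size_scale_leq _ _)) ?size_polyX //.
  by apply: leq_trans (size_polyC_leq1 _) _.
have /irr.2 : 'X - x%:P %| ('X^2 + b *: 'X + c%:P : {poly F}).
  by rewrite dvdp_XsubCl rootE !hornerE rx.
by rewrite size_XsubC => /(_ isT) /eqp_size; rewrite size_XsubC sz.
Qed.

Lemma anisotropic_tail (x y : F) : x ^+ 2 + b * x * y + c * y ^+ 2 = 0 -> x = 0 /\ y = 0.
Proof.
move=> xy; have [y0|y0] := eqVneq y 0.
  move: xy; rewrite y0 expr0n /= !mulr0 !addr0 => /eqP.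
  by rewrite expf_eq0 => /andP[_ /eqP].
(* Dividing by [y ^+ 2] would make [x / y] a root of the irreducible quadratic. *)
case/eqP: (irr_no_root (x / y)).
by apply: (mulIf (expf_neq0 2 y0)); rewrite mul0r -xy; field.
Qed.

Lemma no_totally_singular_line (U : {vspace 'rV[F]_4}) : \dim U = 2%N ->
  exists2 u, u \in U & elliptic_form b c u != 0.
Proof.
move=> U2.
(* Singular vectors of [U] with [X_0 = 0], resp. [X_1 = 0], are multiples of the
   basis vectors [e_1], resp. [e_0], so the form is [u_1 v_0 != 0] at [u + v]. *)
have [u uU /andP[u_neq0 /eqP u0]] := exists_zero_coord (inord 0) U2.
have [v vU /andP[v_neq0 /eqP v1]] := exists_zero_coord (inord 1) U2.
have [qu|] := eqVneq (elliptic_form b c u) 0; last by exists u.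
have [qv|] := eqVneq (elliptic_form b c v) 0; last by exists v.
have [u2 u3] : u ord0 (inord 2) = 0 /\ u ord0 (inord 3) = 0.
  by apply: anisotropic_tail; move: qu; rewrite /elliptic_form u0 mul0r add0r.
have [v2 v3] : v ord0 (inord 2) = 0 /\ v ord0 (inord 3) = 0.
  by apply: anisotropic_tail; move: qv; rewrite /elliptic_form v1 mulr0 add0r.
exists (u + v); first exact: memvD.
rewrite /elliptic_form !mxE u0 v1 u2 u3 v2 v3 !(addr0, add0r, mulr0, expr0n) /=.
rewrite mulf_neq0 //.
  by apply: contraNneq v_neq0 => v0; apply/eqP/row4_eq0 => -[|[|[|[|]]]].
by apply: contraNneq u_neq0 => u1; apply/eqP/row4_eq0 => -[|[|[|[|]]]].
Qed.

Lemma pick_point (P : point F) : exists2 v : 'rV[F]_4, v != 0 & val P = <[v]>%VS.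
Proof.
exists (vpick (val P)).
  by rewrite vpick0 -dimv_eq0 (eqP (valP P)).
apply: val_point_vline (memv_pick _).
by rewrite vpick0 -dimv_eq0 (eqP (valP P)).
Qed.

(** If [u] and [v] span two singular points of the line, the form at [s *: u + t *: v] is [s * t]
    times the polar value. A third singular point has [s * t != 0], which kills that value and makes
    the whole line singular. *)
Lemma line_meets_Qminus (l : {set point F}) : l \in lines F -> (#|l :&: Qminus b c| <= 2)%N.
Proof.
case/imsetP => U /[!inE] /eqP U2 ->; rewrite leqNgt; apply/negP.
case/card_gt2P => P [Q [R [[Pl Ql Rl] [PQ QR RP]]]].
have sing (X : point F) v : X \in points_of U :&: Qminus b c -> v \in val X ->
    elliptic_form b c v = 0.
  by rewrite !inE => /andP[_ /forallP/(_ v)/implyP h] /h /eqP.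
have inU (X : point F) : X \in points_of U :&: Qminus b c -> X \in points_of U.
  by case/setIP.
have UE := points_of_line PQ U2 (inU _ Pl) (inU _ Ql).
have [u u0 Pu] := pick_point P; have [v v0 Qv] := pick_point Q.
have [w w0 Rw] := pick_point R.
have qu : elliptic_form b c u = 0 by apply: sing Pl _; rewrite Pu memv_line.
have qv : elliptic_form b c v = 0 by apply: sing Ql _; rewrite Qv memv_line.
have qw : elliptic_form b c w = 0 by apply: sing Rl _; rewrite Rw memv_line.
have combU z : z \in U -> exists s t : F, z = s *: u + t *: v.
  rewrite UE Pu Qv => /memv_addP[x /vlineP[s ->] [y /vlineP[t ->] ->]].
  by exists s, t.
have [s [t wE]] : exists s t : F, w = s *: u + t *: v.
  by apply: combU; have := inU _ Rl; rewrite inE Rw -memvE.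
have st : s * t != 0.
  rewrite mulf_neq0 //.
    apply: contraNneq QR => s0; apply/eqP/val_inj; rewrite /= Rw.
    by apply: val_point_vline => //; rewrite Qv wE s0 scale0r add0r memvZ ?memv_line.
  apply: contraNneq RP => t0; apply/eqP/val_inj; rewrite /= Rw.
  by apply/esym/val_point_vline => //; rewrite Pu wE t0 scale0r addr0 memvZ ?memv_line.
have Buv : elliptic_polar u v = 0.
  move: qw; rewrite wE elliptic_form_comb qu qv !mulr0 addr0 add0r => /eqP.
  by rewrite mulf_eq0 (negbTE st) => /eqP.
have [z /combU[x [y ->]]] := no_totally_singular_line U2.
by rewrite elliptic_form_comb qu qv Buv !mulr0 !addr0 eqxx.
Qed.
End Quadric.

Lemma card_line_elliptic_quadric (F : finFieldType) (O l : {set point F}) :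
  elliptic_quadric O -> l \in lines F -> #|l :&: O| <= 2.
Proof.
case=> b [c [irr [phi /[!inE] /forallP/(_ l)/eqP philE phiO]]] lL.
rewrite -(card_imset _ (@perm_inj _ phi)) imsetI; last by move=> x y _ _; apply: perm_inj.
by rewrite phiO line_meets_Qminus ?philE.
Qed.

Theorem theorem5 (q e : nat) (F : finFieldType)
    (S S1 S2 : {group {perm (point F)}})
    (Sp : {set {set (point F)}}) (O : {set (point F)}) (P : point F)
    (e_ge1 : 1 <= e) (q_def : q = 2 ^ e) (card_F : #|F| = q)
    (S_singer : singer_cycle S)
    (S1_sub : S1 \subset S) (card_S1 : #|S1| = q + 1)
    (S2_sub : S2 \subset S) (card_S2 : #|S2| = q ^ 2 + 1)
    (Sp_regular : regular_spread Sp)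
    (Sp_stab : forall (g : {perm (point F)}) (l : {set (point F)}),
        g \in S -> l \in Sp -> g @: l \in Sp)
    (S1_fix : forall (g : {perm (point F)}) (l : {set (point F)}),
        g \in S1 -> l \in Sp -> g @: l = l)
    (S1_trans : forall l : {set (point F)},
        l \in Sp -> [transitive S1, on l | 'P])
    (O_elliptic : elliptic_quadric O)
    (Sp_tangent : Sp \subset tangent_lines O)
    (S2_regular : acts_regularly S2 O)
    (P_O : P \in O) :
  starter_set (lines F) S P [set l in tangent_lines O | P \in l].
Proof.
have [Scol _ Sreg] := S_singer; have [S2tr S2free] := S2_regular.
have linesS (g : {perm point F}) l : g \in S -> l \in lines F -> g @: l \in lines F.
  move=> gS lL; have := subsetP Scol g gS.
  by rewrite inE => /forallP/(_ l)/eqP->.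
(* Orbit-stabiliser for [S2] on [O], with trivial stabilisers. *)
have cO : #|O| = (#|F| ^ 2 + 1)%N.
  rewrite card_F -card_S2 -(atransP S2tr _ P_O) card_orbit S2free //.
  by rewrite indexg1.
have arc l := @card_line_elliptic_quadric F O l O_elliptic.
apply: (@starter_set_by_counting _ S Sreg _ Sp _ P #|F|) => //.
- by apply/subsetP => l /[!inE] /andP[/andP[]].
- by move=> l /[!inE] /andP[].
- exact: card_line.
- exact: card_line_pencil.
- exact: card_tangent_pencil.
- have /and3P[/eqP cov triv _] := Sp_regular.1.2.
  have Pcov : P \in cover Sp by rewrite cov inE.
  have pS := pblock_mem Pcov; have Pp : P \in pblock Sp P by rewrite mem_pblock.
  exists (pblock Sp P); split; last by rewrite inE (subsetP Sp_tangent).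
  apply/setP => l; rewrite !inE; apply/andP/eqP => [[lSp Pl]|->] //.
  by rewrite (def_pblock triv lSp Pl).
move=> l lL.
(* If every intersection were even, so would be their sum [(q + 1) * (q ^ 2 + 1)], which is odd
   because [q] is a positive power of 2. *)
have [g gS oddg] : exists2 g, g \in S & odd #|l :&: (g : {perm point F}) @: O|.
  apply/exists_inP; apply: contraT => /exists_inPn ev.
  have : odd (\sum_(g in S) #|l :&: (g : {perm point F}) @: O|) = false.
    apply: (big_ind (fun n => odd n = false)) => // [x y ox oy|g /ev/negbTE //].
    by rewrite oddD ox oy.
  rewrite (sum_card_translates Sreg) (card_line lL) cO oddM addn1 /= oddX /=.
  by rewrite card_F q_def oddX; case: (e) e_ge1.
have giS : (g^-1)%g \in S by rewrite groupV.
have giL := linesS _ _ giS lL.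
have : #|g^-1%g @: l :&: O| == 1.
  move: (arc _ giL) oddg.
  have -> : l :&: g @: O = g @: (g^-1%g @: l :&: O).
    rewrite imsetI ?perm_imsetKV //.
    by move=> x y _ _; apply: perm_inj.
  rewrite card_imset; last exact: perm_inj.
  by case: #|_| => [|[|[|]]].
move=> gl1; have /cards1P[Q QE] := gl1.
have /setIP[Ql QO] : Q \in g^-1%g @: l :&: O by rewrite QE set11.
(* [h] moves the contact point [Q] to [P] while preserving [O], hence tangency. Products of
   permutations act left to right, so [h^-1 * g] brings the resulting tangent back to [l]. *)
have [h hS2 /esym PE] := atransP2 S2tr QO P_O; rewrite /= apermE in PE.
have hS := subsetP S2_sub h hS2.
exists (h @: (g^-1%g @: l)), (h^-1 * g)%g; split.
- rewrite !inE linesS //= -PE imset_f // andbT.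
  have hO : h @: O = O.
    have := acts_act (atrans_acts S2tr) hS2 => hx.
    apply/setP => x; rewrite -[x](permKV h) mem_imset; last exact: perm_inj.
    by have := hx (h^-1%g x); rewrite /= apermE permKV => ->.
  rewrite -{1}hO -imsetI; last by move=> x y _ _; apply: perm_inj.
  by rewrite card_imset //; apply: perm_inj.
- by rewrite groupM ?groupV.
- by rewrite perm_imset_mul perm_imsetK perm_imsetKV.
Qed.
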